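(* Let $\Omega=(0,1)^2$, let $n\ge 2$ and $\varepsilon>0$, and let $\{\hat\Omega_1,\hat\Omega_2\}$ be a partition of $\Omega$ with $\hat\Omega_1$ convex, whose interface $\hat\Gamma=\partial\hat\Omega_1\cap\partial\hat\Omega_2$ is a connected series of $n$ line segments lying on the lines $\mathbf a_i\cdot\mathbf x-b_i=0$, $i=1,\dots,n$, where each $\mathbf a_i$ is a unit vector pointing toward $\hat\Omega_2$. Let $\hat\chi=0$ on $\hat\Omega_1$ and $\hat\chi=1$ on $\hat\Omega_2$, let $\sigma(t)=\max\{0,t\}$, and let $\mathcal N$ be the three-layer ReLU neural network function $$\mathcal N(\mathbf x)=1-\sigma\Big(1-\frac1\varepsilon\sum_{i=1}^n\sigma(\mathbf a_i\cdot\mathbf x-b_i)\Big).$$ Let $\Upsilon_{11},\dots,\Upsilon_{1n}$ and $\Upsilon_{21},\dots,\Upsilon_{2,n-1}$ be the subregions of $\hat\Omega_\varepsilon$ defined in the context. Then $$\hat\chi(\mathbf x)-\mathcal N(\mathbf x)=\begin{cases}0, & \mathbf x\in\Omega\setminus\Big(\bigcup_{j=1}^2\bigcup_{i=1}^{n+1-j}\Upsilon_{ji}\Big),\\[2mm] \hat\chi(\mathbf x)-\frac1\varepsilon(\mathbf a_i\cdot\mathbf x-b_i), & \mathbf x\in\Upsilon_{1i}\ \text{for } i=1,\dots,n,\\[2mm] \hat\chi(\mathbf x)-\frac1\varepsilon\big[(\mathbf a_i+\mathbf a_{i+1})\cdot\mathbf x-(b_i+b_{i+1})\big], & \mathbf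 x\in\Upsilon_{2i}\ \text{for } i=1,\dots,n-1.\end{cases}$$
   Context: Partition: $\{\hat\Omega_1,\hat\Omega_2\}$ is a partition of $\Omega$ if $\hat\Omega_1,\hat\Omega_2$ are open connected subsets of $\Omega$ with $\hat\Omega_1\cap\hat\Omega_2=\emptyset$ and $\bar\Omega=\bar{\hat\Omega}_1\cup\bar{\hat\Omega}_2$. The lines are numbered along the interface, so that segments $i$ and $i+1$ are neighbours. Region $\hat\Omega_\varepsilon$: $\hat\Omega_\varepsilon\subset\Omega$ is the region produced by translating the lines $\mathbf a_i\cdot\mathbf x-b_i=0$ toward $\hat\Omega_2$ along $\mathbf a_i$ by $\varepsilon$, i.e. the region of width $\varepsilon$ on the $\hat\Omega_2$ side between $\hat\Gamma$ and the translated polygonal line. Extending the line segments $\mathbf a_i\cdot\mathbf x-b_i=0$ partitions $\hat\Omega_\varepsilon$ into convex subregions. Subregions of the first type ($\Upsilon_{1i}$ is bounded by the line $\mathbf a_i\cdot\mathbf x-b_i=0$, its translate $\mathbf a_i\cdot\mathbf x-b_i=\varepsilon$, and two neighbouring lines, or one neighbouring line and the boundary of $\Omega$): $\Upsilon_{11}=\{\mathbf x\in\hat\Omega_\varepsilon: 0<\mathbf a_1\cdot\mathbf x-b_1<\varepsilon \text{ and } \mathbf a_2\cdot\mathbf x-b_2<0\}$; $\Upsilon_{1n}=\{\mathbf x\in\hat\Omega_\varepsilon: 0<\mathbf a_n\cdot\mathbf x-b_n<\varepsilon \text{ and } \mathbf a_{n-1}\cdot\mathbf x-b_{n-1}<0\}$;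 and for $i=2,\dots,n-1$, $\Upsilon_{1i}=\{\mathbf x\in\hat\Omega_\varepsilon: 0<\mathbf a_i\cdot\mathbf x-b_i<\varepsilon,\ \mathbf a_{i-1}\cdot\mathbf x-b_{i-1}<0, \text{ and } \mathbf a_{i+1}\cdot\mathbf x-b_{i+1}<0\}$. Subregions of the second type: $\hat\Omega_\varepsilon\setminus\bigcup_{i=1}^n\Upsilon_{1i}$ consists of $n-1$ convex quadrilaterals; each is subdivided into two triangles and the triangle not adjacent to $\hat\Gamma$ is removed. The remaining triangles are, for $i=1,\dots,n-1$, $\Upsilon_{2i}=\{\mathbf x\in\hat\Omega_\varepsilon:\ \mathbf a_j\cdot\mathbf x-b_j>0 \text{ for } j=i,i+1,\ \text{and } (\mathbf a_i+\mathbf a_{i+1})\cdot\mathbf x-(b_i+b_{i+1})<\varepsilon\}$.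
   Formalization: ε is assumed small enough that the n−1 corner quadrilaterals are disjoint (else three terms can be positive), and the zero case omits the interface, where χ̂ is undefined, and points of Ω̂_ε on the extended lines a_i·x=b_i, which lie in no subregion and where it fails. *)

(* Defs.v *)
From HB Require Import structures.
From mathcomp Require Import all_boot all_order all_algebra.
From mathcomp Require Import all_classical all_reals all_analysis.
Import Order.TTheory GRing.Theory Num.Theory.
Import numFieldNormedType.Exports.

Set Implicit Arguments.
Unset Strict Implicit.
Unset Printing Implicit Defensive.

Local Open Scope classical_set_scope.
Local Open Scope ring_scope.

Section Plane.
Variable R : realType.
Implicit Types (p q u v x : 'rV[R]_2) (A Omega : set 'rV[R]_2).

Definition dot u v : R := \sum_(k < 2) u 0 k * v 0 k.

(* The library norm on ['rV[R]_2] is the sup norm, hence this one. *)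
Definition enorm u : R := Num.sqrt (dot u u).

Definition boundary A : set 'rV[R]_2 := closure A `\` interior A.

Definition unit_square : set 'rV[R]_2 := [set x | forall k, 0 < x 0 k < 1].

Definition segment p q : set 'rV[R]_2 :=
  [set (1 - t) *: p + t *: q | t in `[0, 1]].

Definition open_segment p q : set 'rV[R]_2 :=
  [set (1 - t) *: p + t *: q | t in `]0, 1[].

Definition is_partition Omega Omega1 Omega2 : Prop :=
  [/\ [/\ Omega1 `<=` Omega, open Omega1 & connected Omega1],
      [/\ Omega2 `<=` Omega, open Omega2 & connected Omega2],
      Omega1 `&` Omega2 = set0 &
      closure Omega = closure Omega1 `|` closure Omega2].

Definition interface Omega1 Omega2 : set 'rV[R]_2 :=
  boundary Omega1 `&` boundary Omega2.

End Plane.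

Section Polyline.
Variables (R : realType) (n : nat).
Implicit Types (p : 'I_n.+1 -> 'rV[R]_2) (i j : 'I_n).

Definition consecutive i j : bool := j == i.+1 :> nat.

Definition neighbours i j : bool := consecutive i j || consecutive j i.

(* [side p i] joins the vertices of index [i] and [i.+1]. *)
Definition side_start p i := p (widen_ord (leqnSn n) i).
Definition side_end p i := p (lift ord0 i).
Definition side p i := segment (side_start p i) (side_end p i).

(* A simple open chain: side [i] and side [i.+1] share exactly one endpoint,
   and no other two sides meet. In particular the chain does not close up. *)
Definition simple_chain p : Prop :=
  [/\ forall i, side_start p i != side_end p i,
      forall i j, consecutive i j -> side p i `&` side p j = [set side_end p i] &
      forall i j, (i.+1 < j)%N -> side p i `&` side p j = set0].

End Polyline.

Section Lines.
Variables (R : realType) (n : nat).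
Variables (a : 'I_n -> 'rV[R]_2) (b : 'I_n -> R).
Implicit Types (i j : 'I_n) (x : 'rV[R]_2).

Definition lin i x : R := dot (a i) x - b i.

(* The interface of [Omega1] and [Omega2] is the chain with vertices [p], its
   [i]-th side lies on the line [lin i x = 0], and the unit vector [a i],
   attached at any point inside that side, points into [Omega2]. *)
Definition polygonal_interface (Omega1 Omega2 : set 'rV[R]_2)
    (p : 'I_n.+1 -> 'rV[R]_2) : Prop :=
  [/\ interface Omega1 Omega2 = \bigcup_(i in [set: 'I_n]) side p i,
      simple_chain p,
      forall i, side p i `<=` [set x | lin i x = 0],
      forall i, enorm (a i) = 1 &
      forall i x, open_segment (side_start p i) (side_end p i) x ->
        \forall t \near 0^'+, Omega2 (x + t *: a i)].

Definition relu (t : R) : R := Num.max 0 t.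

Definition network (eps : R) x : R :=
  1 - relu (1 - eps^-1 * \sum_(i < n) relu (lin i x)).

Variables (Omega2 : set 'rV[R]_2) (eps : R).

(* Translating every line by [eps] along [a i] gives the convex chain bounding
   [forall i, lin i x < eps]; the strip lies between the interface and it. *)
Definition strip : set 'rV[R]_2 :=
  [set x | Omega2 x /\ forall i, lin i x < eps].

(* The end sides have one neighbour, the other ones have two. *)
Definition Upsilon1 i : set 'rV[R]_2 :=
  [set x | [/\ strip x, 0 < lin i x < eps &
               forall j, neighbours i j -> lin j x < 0]].

(* [Upsilon2 i j] and [corner i j] are meant for [consecutive i j]. *)
Definition Upsilon2 i j : set 'rV[R]_2 :=
  [set x | [/\ strip x, 0 < lin i x, 0 < lin j x &
               dot (a i + a j) x - (b i + b j) < eps]].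

(* The second-type region at the vertex common to sides [i] and [j], before
   its outer triangle is removed. *)
Definition corner i j : set 'rV[R]_2 :=
  [set x | [/\ strip x, 0 < lin i x & 0 < lin j x]].

(* What remains of the strip after the first-type regions consists of [n - 1]
   separate quadrilaterals, one per inner vertex. This bounds [eps] in terms of
   the polyline: for larger [eps] some points of the strip are on the positive
   side of three lines, and there the network is a sum of three terms. *)
Definition corners_separate : Prop :=
  trivIset [set ij : 'I_n * 'I_n | consecutive ij.1 ij.2]
           (fun ij => corner ij.1 ij.2).

Definition Upsilons : set 'rV[R]_2 :=
  \bigcup_(i in [set: 'I_n]) Upsilon1 i `|`
  \bigcup_(ij in [set ij : 'I_n * 'I_n | consecutive ij.1 ij.2])
     Upsilon2 ij.1 ij.2.

(* The lines that cut the strip into its open subregions; they belong to none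
   of the subregions. *)
Definition cuts : set 'rV[R]_2 :=
  [set x | strip x /\ exists i, lin i x = 0].

End Lines.

(* Main.v *)
(* Every open half-plane [0 < lin i] misses the convex set [Omega1], so the
   network vanishes there. For [x] in [Omega2], the set of indices [i] with
   [0 < lin i x] is nonempty and is an interval: projecting radially, from a
   point of [Omega1], the segment joining [x] to a side in front of which [x]
   lies gives a connected part of the interface, which avoids every side [m]
   with [lin m x <= 0] and hence cannot pass from the sides before [m] to those
   after [m]. On a first-type region this interval is a single index, and on a
   second-type one a consecutive pair, since the corners are separate. So the
   inner sum of the network has exactly one, resp. two, nonzero terms; elsewhere
   in [Omega2], off the cuts, it is at least [eps]. *)
Require Import Defs.
From HB Require Import structures.
From mathcomp Require Import all_boot all_order all_algebra.
From mathcomp Require Import all_classical all_reals all_analysis.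
From mathcomp Require Import ring lra.
Import Order.TTheory GRing.Theory Num.Theory.
Import numFieldNormedType.Exports.

Set Implicit Arguments.
Unset Strict Implicit.
Unset Printing Implicit Defensive.

Local Open Scope classical_set_scope.
Local Open Scope ring_scope.

(** * Open convex sets, and connectedness of a segment *)

Section Convex.
Variables (R : realType) (V : normedModType R).
Implicit Types (A B : set V) (u v w x y z : V) (s t : R).

Lemma continuous_line y w : continuous (fun t : R => y + t *: w).
Proof. by move=> t; apply: cvgD; [exact: cvg_cst|exact: cvgZr_tmp]. Qed.

Lemma convex_line A (cA : convex_set (A : set (convex_lmodType V))) y z t :
  A y -> A z -> 0 <= t <= 1 -> A (y + t *: (z - y)).
Proof.
move=> Ay Az /andP[t0 t1].
have := cA z y (Itv01 t0 t1); rewrite !inE => /(_ Az Ay).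
congr A; rewrite /conv /=; rewrite scalerBr scalerBl scale1r.
by rewrite addrCA addrA.
Qed.

Lemma convex_open_closure A (cA : convex_set (A : set (convex_lmodType V)))
    y z t :
  open A -> A y -> closure A z -> 0 <= t < 1 -> A (y + t *: (z - y)).
Proof.
move=> oA Ay clz /andP[t0 t1].
have t1' : 1 - t != 0 by rewrite subr_eq0 gt_eqF.
(* Moving the end point from [z] to a nearby [z'] in [A], the starting point
   that keeps the intermediate point in place stays close to [y]. *)
pose g z' := y - (t / (1 - t)) *: (z' - z).
have gz : g z = y by rewrite /g subrr scaler0 subr0.
have cg : {for z, continuous g}.
  apply: cvgB; first exact: cvg_cst.
  by apply: cvgZl_tmp; apply: cvgB => //; exact: cvg_cst.
have ng : nbhs z (g @^-1` A).
  by apply: cg; rewrite gz; apply: open_nbhs_nbhs.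
have [z' [Az' Agz']] := clz _ ng.
have -> : y + t *: (z - y) = g z' + t *: (z' - g z').
  rewrite /g; set k := t / (1 - t).
  have -> : z' - (y - k *: (z' - z)) = (z - y) + (1 + k) *: (z' - z).
    rewrite scalerDl scale1r opprB [_ *: _ - y]addrC addrACA.
    by rewrite [z + _]addrC subrK.
  rewrite [in RHS](scalerDr t) scalerA addrACA -scaleNr -scalerDl.
  suff -> : - k + t * (1 + k) = 0 by rewrite scale0r addr0.
  by rewrite /k; field.
by apply: convex_line => //; rewrite t0 ltW.
Qed.

(** Without such a [t], the parameters of the points in [A] would form a nonempty clopen part of the
    interval [0, 1], hence all of it. *)
Lemma boundary_crossing A y v : open A -> A y -> ~ A v ->
  exists t, [/\ 0 < t, t <= 1 & (closure A `\` A) (y + t *: (v - y))].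
Proof.
move=> oA Ay nAv; apply: contrapT => noex.
pose f t := y + t *: (v - y).
have no t : 0 <= t <= 1 -> closure A (f t) -> A (f t).
  move=> /andP[t0 t1] clt; apply: contrapT => nA; apply: noex.
  exists t; split => //; rewrite lt_neqAle t0 andbT.
  apply/eqP => t00; apply: nA; rewrite /f -t00 scale0r addr0 //.
have : `[0, 1]%classic `&` f @^-1` A = `[0, 1]%classic.
  apply: (@segment_connected R 0 1).
  - by exists 0; split; rewrite /= ?in_itv /= ?lexx ?ler01 // /f scale0r addr0.
  - exists (f @^-1` A) => //; apply: open_comp => // t _.
    exact: continuous_line.
  - exists (f @^-1` closure A).
      apply: preimage_closed; last exact: closed_closure.
      by move=> t _; exact: continuous_line.
    apply/seteqP; split => t [/= t01 At]; split => //.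
      exact: subset_closure.
    by apply: no => //; rewrite in_itv /= in t01.
move/seteqP => [_ /(_ 1)] /=; rewrite in_itv /= ler01 lexx => /(_ isT) [_].
by rewrite /f scale1r addrC subrK.
Qed.

(** A projection of a compact set of pairs [(s, t)]. It tells which points of the segment from [u]
    to [x] are screened from [y] by [A]. *)
Lemma closed_shadow A y u x : closed A ->
  closed [set s : R | 0 <= s <= 1 /\
    exists2 t, 0 <= t <= 1 & A (y + t *: (u + s *: (x - u) - y))].
Proof.
move=> cA; pose f (st : R * R) := y + st.2 *: (u + st.1 *: (x - u) - y).
have cf : continuous f.
  move=> st; apply: cvgD; first exact: cvg_cst.
  apply: cvgZ; first exact: cvg_snd.
  apply: cvgB; last exact: cvg_cst.
  apply: cvgD; first exact: cvg_cst.
  by apply: cvgZr_tmp; exact: cvg_fst.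
pose K : set (R * R) := `[0, 1]%classic `*` `[0, 1]%classic.
have cK : compact (K `&` f @^-1` A).
  apply: compact_closedI; first by apply: compact_setX; exact: segment_compact.
  by apply: preimage_closed => // ? _; exact: cf.
rewrite (_ : mkset _ = fst @` (K `&` f @^-1` A)).
  apply: compact_closed; first exact: norm_hausdorff.
  apply: continuous_compact => //; apply: continuous_subspaceT => ?.
  exact: cvg_fst.
apply/seteqP; split => [s [s01 [t t01 At]]|s [[s' t] [[/= s01 t01] At] <-]].
  by exists (s, t) => //; split => //; split; rewrite /= in_itv.
by rewrite !in_itv /= in s01 t01; split => //; exists t.
Qed.

End Convex.

(** If the two sets were disjoint on [0, 1], [A] would be relatively clopen there and so would
    contain [s1]. *)
Lemma closed_cover_meet (R : realType) (A B : set R) s0 s1 :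
  closed A -> closed B -> `[0, 1]%classic `<=` A `|` B ->
  0 <= s0 <= 1 -> 0 <= s1 <= 1 -> A s0 -> B s1 ->
  exists s, [/\ 0 <= s <= 1, A s & B s].
Proof.
move=> cA cB cov s0I s1I As0 Bs1; apply: contrapT => nAB.
have : `[0, 1]%classic `&` A = `[0, 1]%classic.
  apply: (@segment_connected R 0 1).
  - by exists s0; split; rewrite //= in_itv.
  - exists (~` B); first exact: closed_openC.
    apply/seteqP; split => s [sI]; split => //.
      by move=> Bs; apply: nAB; exists s; rewrite /= in_itv in sI.
    by have [] := cov _ sI.
  - by exists A.
move/seteqP => [_ /(_ s1)]; rewrite /= in_itv /= => /(_ s1I) [_ As1].
by apply: nAB; exists s1.
Qed.

(** * Plane vectors, segments and the unit square *)

Section Plane.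
Variable R : realType.
Implicit Types (u v w x y z : 'rV[R]_2).

Lemma dotE u v : dot u v = u 0 0 * v 0 0 + u 0 1 * v 0 1.
Proof.
rewrite /dot !big_ord_recl big_ord0 addr0.
by congr (_ + u 0 _ * v 0 _); apply: val_inj.
Qed.

Lemma rV2P u v : u 0 0 = v 0 0 -> u 0 1 = v 0 1 -> u = v.
Proof.
move=> e0 e1; apply/rowP => k.
by case: (unliftP 0 k) => [j|] -> //; rewrite (ord1 j) (_ : lift _ _ = 1) //;
  apply: val_inj.
Qed.

Lemma enorm1_dot u : enorm u = 1 -> dot u u = 1.
Proof.
move=> u1; have u0 : 0 <= dot u u by rewrite dotE -!expr2 addr_ge0 ?sqr_ge0.
by rewrite -[LHS]sqr_sqrtr // -/(enorm u) u1 expr1n.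
Qed.

Lemma orthogonal_decomposition u v w : dot u u = 1 -> dot u v = 0 -> v != 0 ->
  exists c, w = dot u w *: u + c *: v.
Proof.
rewrite !dotE => uu uv v0.
(* The determinant of [u] and [v]: being orthogonal to the unit vector [u], [v] is [k] times the
   quarter turn of [u]. *)
pose k := u 0 0 * v 0 1 - u 0 1 * v 0 0.
have v0E : v 0 0 = - k * u 0 1.
  transitivity ((u 0 0 * u 0 0 + u 0 1 * u 0 1) * v 0 0
    - u 0 0 * (u 0 0 * v 0 0 + u 0 1 * v 0 1)); last by rewrite /k; ring.
  by rewrite uu uv; ring.
have v1E : v 0 1 = k * u 0 0.
  transitivity ((u 0 0 * u 0 0 + u 0 1 * u 0 1) * v 0 1
    - u 0 1 * (u 0 0 * v 0 0 + u 0 1 * v 0 1)); last by rewrite /k; ring.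
  by rewrite uu uv; ring.
have k0 : k != 0.
  apply: contra_neq v0 => k0.
  by apply: rV2P; rewrite mxE ?v0E ?v1E k0 ?oppr0 mul0r.
exists ((u 0 0 * w 0 1 - u 0 1 * w 0 0) / k).
apply: rV2P; rewrite !mxE ?v0E ?v1E.
- transitivity ((u 0 0 * u 0 0 + u 0 1 * u 0 1) * w 0 0).
    by rewrite uu mul1r.
  by field.
- transitivity ((u 0 0 * u 0 0 + u 0 1 * u 0 1) * w 0 1).
    by rewrite uu mul1r.
  by field.
Qed.

Lemma closed_segment (p q : 'rV[R]_2) : closed (segment p q).
Proof.
apply: compact_closed; first exact: norm_hausdorff.
apply: continuous_compact; last exact: segment_compact.
apply: continuous_subspaceT => t; apply: cvgD; apply: cvgZr_tmp => //.
by apply: cvgB => //; exact: cvg_cst.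
Qed.

Lemma unit_square_open : open (@unit_square R).
Proof.
rewrite openE => x xI.
suff : \forall y \near x, forall k, 0 < (y : 'rV[R]_2) 0 k < 1 by [].
apply: (@filter_forall _ _ (fun k (y : 'rV[R]_2) => is_true (0 < y 0 k < 1))
  _ (nbhs_filter x)) => k.
apply: (@coord_continuous R 1 2 0 k x [set r | 0 < r < 1]).
have := @near_in_itvoo R 0 1 (x 0 k); rewrite in_itv /= xI => /(_ isT).
by apply: filterS => r; rewrite in_itv.
Qed.

Lemma unit_square_convex :
  convex_set (@unit_square R : set (convex_lmodType 'rV[R]_2)).
Proof.
apply/convex_setW => x y; rewrite !inE => xI yI t t0 t1; rewrite inE => k.
have /andP[x0 x1] := xI k; have /andP[y0 y1] := yI k.
rewrite /conv /= !mxE /unstable.onem; nra.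
Qed.

(** * Frontier of the convex piece of a partition *)

Section Partition.
Variables (Omega Omega1 Omega2 : set 'rV[R]_2).
Hypothesis oO : open Omega.
Hypothesis partO : is_partition Omega Omega1 Omega2.
Hypothesis convO1 : convex_set (Omega1 : set (convex_lmodType 'rV[R]_2)).

Lemma partition_disjoint x : Omega1 x -> Omega2 x -> False.
Proof. by case: partO => _ _ + _ x1 x2 => /seteqP[/(_ x) + _]; exact. Qed.

Lemma closure_partition_disjoint x : closure Omega1 x -> Omega2 x -> False.
Proof.
case: partO => _ [_ o2 _] _ _ clx x2.
have [z [z1 z2]] := clx _ (open_nbhs_nbhs (conj o2 x2)).
exact: partition_disjoint z1 z2.
Qed.

(** If [z] were away from [Omega2], pushing it slightly further from [y] would stay in the closure
    of [Omega1], and convexity would put [z] itself in [Omega1]. *)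
Lemma frontier_sub_interface y z :
  Omega1 y -> Omega z -> closure Omega1 z -> ~ Omega1 z ->
  interface Omega1 Omega2 z.
Proof.
move=> y1 Oz clz nz; have [[s1 o1 _] [s2 o2 _] _ clO] := partO.
split; split => //; try by move/interior_subset.
- apply: contrapT => nclz; apply: nz.
  have nU : nbhs (z + 0 *: (z - y)) (Omega `&` ~` closure Omega2).
    rewrite scale0r addr0; apply: open_nbhs_nbhs; split => //.
    by apply: openI => //; apply: closed_openC; exact: closed_closure.
  have nd : \forall d \near 0^'+,
      (Omega `&` ~` closure Omega2) (z + d *: (z - y)).
    by apply: cvg_at_right_filter nU; exact: continuous_line.
  have /filter_ex[d [d0 [Od nd2]]] :
      \forall d \near (0 : R)^'+, 0 < d /\
      (Omega `&` ~` closure Omega2) (z + d *: (z - y)).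
    by apply: filterI => //; exact: nbhs_right_gt.
  have : closure Omega (z + d *: (z - y)) by exact: subset_closure.
  rewrite clO => -[cl1|//].
  have -> : z = y + (1 + d)^-1 *: (z + d *: (z - y) - y).
    by apply: rV2P; rewrite !mxE; field; rewrite gt_eqF ?addr_gt0.
  apply: convex_open_closure => //.
  by rewrite invr_ge0 addr_ge0 ?ltW //= invf_lt1 ?ltrDl // addr_gt0.
- by move/interior_subset; exact: closure_partition_disjoint.
Qed.

End Partition.
End Plane.

(** * Signs of the [lin i] on the two pieces, for a polygonal interface *)

Section PolygonalInterface.
Variables (R : realType) (n : nat) (Omega1 Omega2 : set 'rV[R]_2).
Variables (p : 'I_n.+1 -> 'rV[R]_2) (a : 'I_n -> 'rV[R]_2) (b : 'I_n -> R).
Hypothesis partO : is_partition (@unit_square R) Omega1 Omega2.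
Hypothesis convO1 : convex_set (Omega1 : set (convex_lmodType 'rV[R]_2)).
Hypothesis interO : polygonal_interface a b Omega1 Omega2 p.
Implicit Types (i j k m : 'I_n) (u v x y z : 'rV[R]_2).

Local Notation L := (lin a b).

Let open1 : open Omega1. Proof. by case: partO => -[]. Qed.
Let sub1 : Omega1 `<=` @unit_square R. Proof. by case: partO => -[]. Qed.
Let sub2 : Omega2 `<=` @unit_square R. Proof. by case: partO => _ []. Qed.

Lemma lin_line i y v t : L i (y + t *: (v - y)) = L i y + t * (L i v - L i y).
Proof. by rewrite /lin !dotE !mxE; ring. Qed.

Lemma lin_side i x : side p i x -> L i x = 0.
Proof. by case: interO => _ _ + _ _; exact. Qed.

Lemma side_startP i : side p i (side_start p i).
Proof.
by exists 0; rewrite /= ?in_itv /= ?lexx ?ler01 // subr0 scale1r scale0r addr0.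
Qed.

Lemma side_endP i : side p i (side_end p i).
Proof.
by exists 1; rewrite /= ?in_itv /= ?lexx ?ler01 // subrr scale1r scale0r add0r.
Qed.

Lemma side_boundary i x : side p i x -> closure Omega1 x /\ ~ Omega1 x.
Proof.
move=> ix; have [eqI _ _ _ _] := interO.
have : interface Omega1 Omega2 x by rewrite eqI; exists i.
move=> [[cl1 n1] _]; split=> // x1; apply: n1.
by rewrite /interior; apply: open_nbhs_nbhs.
Qed.

(* If [y] were in front of side [i], the triangle spanned by [y] and that side
   would contain points of [Omega1] in front of the midpoint of the side. *)
Lemma lin_le0 i y : Omega1 y -> L i y <= 0.
Proof.
move=> y1; rewrite leNgt; apply/negP => ly0.
have [_ [neq _ _] _ /(_ i)/enorm1_dot aa /(_ i) into2] := interO.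
set P := side_start p i in into2; set Q := side_end p i in into2.
have lP : L i P = 0 by apply: lin_side; exact: side_startP.
have lQ : L i Q = 0 by apply: lin_side; exact: side_endP.
pose x0 := (1 - 2^-1) *: P + 2^-1 *: Q.
have {}into2 : \forall t \near (0 : R)^'+, Omega2 (x0 + t *: a i).
  by apply: into2; exists 2^-1 => //; rewrite /= in_itv /=; lra.
have aPQ : dot (a i) (Q - P) = 0.
  by move: lP lQ; rewrite /lin !dotE !mxE; lra.
have PQ0 : Q - P != 0 by rewrite subr_eq0 eq_sym; exact: neq.
have [c yE] := orthogonal_decomposition (y - x0) aa aPQ PQ0.
have ayE : dot (a i) (y - x0) = L i y.
  by move: lP lQ; rewrite /lin /x0 !dotE !mxE; lra.
rewrite {}ayE in yE; set d := L i y in ly0 yE *.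
(* Keeping [t] below [d / (2 * |c| + 2)] ensures both [l < 1] and [|s| <= 1/2], so that [z] stays on
   the side. *)
have c0 : 0 < 2 * `|c| + 2 by rewrite ltr_wpDl // mulr_ge0.
have e0 : 0 < d / (2 * `|c| + 2) by rewrite divr_gt0.
have : \forall t \near (0 : R)^'+,
    [/\ 0 < t, t < d / (2 * `|c| + 2) & Omega2 (x0 + t *: a i)].
  near=> t; split; near: t; [exact: nbhs_right_gt|
    exact: nbhs_right_lt|exact: into2].
move=> /filter_ex[t [t0 td x2]].
apply: (partition_disjoint partO _ x2).
pose l := t / d.
have tE : t = l * d by rewrite /l divfK // gt_eqF.
have l0 : 0 < l by rewrite divr_gt0.
have lc : l * (2 * `|c| + 2) < 1.
  by rewrite /l mulrAC ltr_pdivrMr // mul1r -ltr_pdivlMr.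
have c0' : 0 <= `|c| by [].
have l1 : l < 1 by nra.
have l1' : 1 - l != 0 by rewrite subr_eq0 gt_eqF.
(* The shift along the side that cancels the tangential part [l * c] contributed by [y], leaving
   only the normal displacement [t]. *)
pose s := l * c / (1 - l).
have sb : `|s| <= 2^-1.
  rewrite /s normrM normfV normrM (gtr0_norm l0) (@gtr0_norm _ (1 - l)); last lra.
  by rewrite ler_pdivrMr; nra.
pose z := (1 - (2^-1 - s)) *: P + (2^-1 - s) *: Q.
have -> : x0 + t *: a i = y + (1 - l) *: (z - y).
  have -> : y = x0 + (d *: a i + c *: (Q - P)) by rewrite -yE addrC subrK.
  by apply: rV2P; rewrite /z /x0 tE /s !mxE; field.
apply: convex_open_closure => //; last by lra.
apply: (side_boundary (i := i) _).1.
exists (2^-1 - s) => //; rewrite /= in_itv /=.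
by move: sb; rewrite ler_norml; lra.
Unshelve. all: by end_near.
Qed.

(** By openness a small step along the unit vector [a i] stays in [Omega1], and it raises [L i] by
    its length. *)
Lemma lin_lt0 i y : Omega1 y -> L i y < 0.
Proof.
move=> y1; have [_ _ _ /(_ i)/enorm1_dot aa _] := interO.
have nA : nbhs (y + 0 *: a i) Omega1.
  by rewrite scale0r addr0; exact: open_nbhs_nbhs.
have : \forall t \near (0 : R)^'+, 0 < t /\ Omega1 (y + t *: a i).
  apply: filterI; first exact: nbhs_right_gt.
  by apply: cvg_at_right_filter nA; exact: continuous_line.
move=> /filter_ex[t [t0 /(lin_le0 i)]]; apply: lt_le_trans.
move: aa; rewrite /lin !dotE !mxE => aa.
rewrite -subr_gt0 [ltRHS](_ : _ = t) //.
by rewrite -[RHS]mulr1 -[in RHS]aa; ring.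
Qed.

Lemma lin_closure_le0 i z y : Omega1 y -> closure Omega1 z -> L i z <= 0.
Proof.
move=> y1 clz; rewrite leNgt; apply/negP => lz.
have ly := lin_lt0 i y1; have d0 : 0 < L i z - L i y by lra.
pose t := - L i y / (L i z - L i y).
have /(lin_lt0 i) : Omega1 (y + t *: (z - y)).
  apply: convex_open_closure => //.
  by rewrite divr_ge0 ?ltr_pdivrMr //; lra.
by rewrite lin_line /t divfK ?gt_eqF // subrr ltxx.
Qed.

(** The segment leaves [Omega1] at a frontier point, which convexity of the square keeps inside the
    square, hence on the interface. *)
Lemma side_crossing y v : Omega1 y -> @unit_square R v -> ~ Omega1 v ->
  exists t k, [/\ 0 < t, t <= 1 & side p k (y + t *: (v - y))].
Proof.
move=> y1 Ov nv; have [t [t0 t1 [clz nz]]] := boundary_crossing open1 y1 nv.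
have [eqI _ _ _ _] := interO.
have : interface Omega1 Omega2 (y + t *: (v - y)).
  apply: (frontier_sub_interface (@unit_square_open R) partO convO1 y1) => //.
  apply: convex_line; [exact: unit_square_convex|exact: sub1| |] => //.
  by rewrite ltW.
by rewrite eqI => -[k _ kz]; exists t, k.
Qed.

(** Take the side crossed on the way from [y] to [x]: its affine form is negative at [y] and zero
    strictly before [x]. *)
Lemma lin_gt0_exists y x : Omega1 y -> Omega2 x -> exists i, 0 < L i x.
Proof.
move=> y1 x2.
have [|t [k [t0 t1 kz]]] := side_crossing y1 (sub2 x2).
  by move=> x1; exact: partition_disjoint partO x x1 x2.
have {}t1 : t < 1.
  rewrite lt_neqAle t1 andbT; apply/eqP => tE.
  apply: (closure_partition_disjoint partO _ x2).
  have [+ _] := side_boundary kz.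
  by rewrite tE scale1r [y + _]addrC subrK.
exists k; have := lin_side kz; have := lin_lt0 k y1; rewrite lin_line; nra.
Qed.

(** Used in both directions, this makes the frontier point on a ray from [y] unique, so that radial
    projection is well defined. *)
Lemma radial_boundary y w s t : Omega1 y -> 0 <= s ->
  closure Omega1 (y + t *: w) -> ~ Omega1 (y + s *: w) -> t <= s.
Proof.
move=> y1 s0 clt ns; rewrite leNgt; apply/negP => st; apply: ns.
have t0 : 0 < t by lra.
have -> : y + s *: w = y + (s / t) *: (y + t *: w - y).
  by rewrite [y + t *: w]addrC addrK scalerA divfK // gt_eqF.
apply: convex_open_closure => //.
by rewrite ltr_pdivrMr // mul1r st divr_ge0 // ltW.
Qed.

(* Radial projection from [y] moves the segment from a point of side [k] to [x]
   to a connected part of the interface, which cannot jump over side [m]. *)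
Lemma crossing_same_side y x k m m1 t : Omega1 y -> Omega2 x ->
  0 < L k x -> L m x <= 0 -> 0 <= t <= 1 -> side p m1 (y + t *: (x - y)) ->
  (k < m)%N = (m1 < m)%N.
Proof.
move=> y1 x2 kx mx t01 m1x.
have [_ [_ _ disj] _ _ _] := interO.
set u := side_start p k.
have ku : side p k u by exact: side_startP.
(* The parameters of the points between [u] and [x] whose radial projection falls on a side with
   index in [P]. *)
pose A (P : pred 'I_n) := [set s : R | 0 <= s <= 1 /\
  exists2 t, 0 <= t <= 1 &
    (\bigcup_(i in P) side p i) (y + t *: (u + s *: (x - u) - y))].
have cA P : closed (A P).
  apply: closed_shadow; apply: closed_bigcup => [|i _].
    exact: finite_finset.
  exact: closed_segment.
have A0 (P : pred 'I_n) : P k -> A P 0.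
  move=> Pk; split; first by rewrite lexx ler01.
  exists 1; first by rewrite lexx ler01.
  by exists k => //; rewrite scale0r addr0 scale1r addrC subrK.
have A1 (P : pred 'I_n) : P m1 -> A P 1.
  move=> Pm; split; first by rewrite lexx ler01.
  by exists t => //; exists m1 => //; rewrite scale1r [u + _]addrC subrK.
pose lo : pred 'I_n := fun i => (i < m)%N.
pose hi : pred 'I_n := fun i => (m < i)%N.
(* Both crossings are the same point of the ray, whereas sides separated by [m] are not adjacent and
   so are disjoint. *)
have meet s : A lo s -> A hi s -> False.
  move=> [_ [t1 /andP[t1_ge0 _] [i im iz]]] [_ [t2 /andP[t2_ge0 _] [j mj jz]]].
  have [ci ni] := side_boundary iz; have [cj nj] := side_boundary jz.
  have tE : t1 = t2.
    by apply/le_anti; rewrite (radial_boundary y1 t1_ge0 cj ni)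
      (radial_boundary y1 t2_ge0 ci nj).
  have /seteqP[/(_ _ (conj iz _))] := disj i j (leq_ltn_trans im mj).
  by rewrite tE => /(_ jz).
have km : k != m by apply: contraTneq kx => ->; rewrite -leNgt.
have cover s : 0 <= s <= 1 -> A lo s \/ A hi s.
  move=> /andP[s0 s1].
  have lohi j : j != m -> lo j \/ hi j.
    by rewrite /lo /hi neq_ltn => /orP.
  have [->|sn0] := eqVneq s 0.
    by case: (lohi _ km) => /A0; [left|right].
  have s_gt0 : 0 < s by rewrite lt_neqAle eq_sym sn0.
  set v := u + s *: (x - u).
  (* Past [u] the point [v] is strictly in front of side [k], hence off the closure of [Omega1]. *)
  have kv : 0 < L k v by rewrite lin_line (lin_side ku) subr0 add0r mulr_gt0.
  have ncv : ~ closure Omega1 v.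
    by move/(lin_closure_le0 k y1); rewrite leNgt kv.
  have Ov : @unit_square R v.
    have -> : v = x + (1 - s) *: (u - x).
      by apply: rV2P; rewrite !mxE; ring.
    apply: convex_open_closure; [exact: unit_square_convex|
      exact: unit_square_open|exact: sub2| |lra].
    by apply: closureS (side_boundary ku).1; exact: sub1.
  have [|t' [j [t'0 t'1 jz]]] := side_crossing y1 Ov.
    by move=> v1; apply: ncv; exact: subset_closure.
  (* As [L m] is negative at [y] and at most zero at [v], it can vanish only at the end [v], which
     is not on the interface. *)
  have jm : j != m.
    apply/eqP => jm; rewrite {}jm in jz.
    have := lin_side jz; rewrite lin_line => mz.
    have my := lin_lt0 m y1.
    have mu : L m u <= 0 := lin_closure_le0 m y1 (side_boundary ku).1.
    have mv : L m v <= 0 by rewrite /v lin_line; nra.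
    have t'E : t' = 1 by apply/le_anti; rewrite t'1 /=; nra.
    apply: ncv; have [+ _] := side_boundary jz.
    by rewrite t'E scale1r [y + _]addrC subrK.
  case: (lohi _ jm) => jP; [left|right]; split; rewrite ?s0 //;
    by exists t'; [rewrite (ltW t'0)|exists j].
have m1m : m1 != m.
  apply/eqP => m1m; rewrite {}m1m in m1x A1.
  have := lin_side m1x; rewrite lin_line => mz; have my := lin_lt0 m y1.
  have tE : t = 1 by apply/le_anti; case/andP: t01 => t0 t1; rewrite t1 /=; nra.
  apply: (closure_partition_disjoint partO _ x2).
  have [+ _] := side_boundary m1x.
  by rewrite tE scale1r [y + _]addrC subrK.
have meetF s0 s1 : 0 <= s0 <= 1 -> 0 <= s1 <= 1 -> A lo s0 -> A hi s1 -> False.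
  move=> s0I s1I lo0 hi1.
  have [|s [_]] := closed_cover_meet (cA lo) (cA hi) _ s0I s1I lo0 hi1.
    by move=> s /=; rewrite in_itv /=; exact: cover.
  exact: meet.
have I0 : 0 <= (0 : R) <= 1 by rewrite lexx ler01.
have I1 : 0 <= (1 : R) <= 1 by rewrite lexx ler01.
have {}km : k != m :> nat := km; have {}m1m : m1 != m :> nat := m1m.
(* If [m] separated [k] from [m1], the ends [0] and [1] would lie in different closed sets of the
   cover. *)
case: (ltngtP k m) km => // km _;
  case: (ltngtP m1 m) m1m => // m1m _.
- by case: (meetF 0 1 I0 I1 (A0 lo km) (A1 hi m1m)).
- by case: (meetF 1 0 I1 I0 (A1 lo m1m) (A0 hi km)).
Qed.

(** Otherwise [k] and [i] would both be on the same side of [m] as the index of the side crossed on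
    the way to [x]. *)
Lemma lin_gt0_between y x k m i : Omega1 y -> Omega2 x ->
  (k < m)%N -> (m < i)%N -> 0 < L k x -> 0 < L i x -> 0 < L m x.
Proof.
move=> y1 x2 km mi kx ix; rewrite ltNge; apply/negP => mx.
have [|t [m1 [t0 t1 m1x]]] := side_crossing y1 (sub2 x2).
  by move=> x1; exact: partition_disjoint partO x x1 x2.
have t01 : 0 <= t <= 1 by rewrite ltW.
have := crossing_same_side y1 x2 kx mx t01 m1x.
rewrite -(crossing_same_side y1 x2 ix mx t01 m1x) km.
by rewrite ltnNge ltnW.
Qed.

(** The index after [i] is [j] or lies strictly between. This replaces a distant positive line by a
    neighbouring one, as the definitions of the regions require. *)
Lemma lin_gt0_next y x i j : Omega1 y -> Omega2 x ->
  (i < j)%N -> 0 < L i x -> 0 < L j x ->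
  exists2 k, consecutive i k & 0 < L k x.
Proof.
move=> y1 x2 ij ix jx.
have kn : (i.+1 < n)%N by exact: leq_ltn_trans ij (ltn_ord j).
exists (Ordinal kn); first by rewrite /consecutive.
move: (ij); rewrite leq_eqVlt => /orP[/eqP e|lt].
  by rewrite (_ : Ordinal kn = j) //; exact: val_inj.
exact: (lin_gt0_between y1 x2 (k := i) (i := j)).
Qed.

Lemma lin_gt0_prev y x i j : Omega1 y -> Omega2 x ->
  (i < j)%N -> 0 < L i x -> 0 < L j x ->
  exists2 k, consecutive k j & 0 < L k x.
Proof.
move=> y1 x2 ij ix jx; have j0 : (0 < j)%N by exact: leq_ltn_trans ij.
have kn : (j.-1 < n)%N by exact: leq_ltn_trans (leq_pred j) (ltn_ord j).
exists (Ordinal kn); first by rewrite /consecutive /= prednK.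
have ik : (i <= Ordinal kn)%N by rewrite /= -ltnS prednK.
move: ik; rewrite leq_eqVlt => /orP[/eqP e|lt].
  by rewrite (_ : Ordinal kn = i) //; exact: val_inj.
by apply: (lin_gt0_between y1 x2 lt _ ix jx); rewrite ltn_predL.
Qed.

End PolygonalInterface.

(** * Saturated and linear regimes of the network *)

Section Network.
Variables (R : realType) (n : nat) (a : 'I_n -> 'rV[R]_2) (b : 'I_n -> R).
Implicit Types (i j : 'I_n) (x : 'rV[R]_2) (eps t : R).

Lemma relu_ge0 t : 0 <= relu t.
Proof. by rewrite /relu le_max lexx. Qed.

Lemma le_relu t : t <= relu t.
Proof. by rewrite /relu le_max lexx orbT. Qed.

Lemma relu_eq0 t : t <= 0 -> relu t = 0.
Proof. by move=> t0; apply/max_idPl. Qed.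

Lemma relu_id t : 0 <= t -> relu t = t.
Proof. by move=> t0; apply/max_idPr. Qed.

Lemma network_eq1 eps x : 0 < eps ->
  eps <= \sum_i relu (lin a b i x) -> network a b eps x = 1.
Proof.
move=> eps0 le_eps; rewrite /network relu_eq0 ?subr0 //.
by rewrite subr_le0 mulrC ler_pdivlMr // mul1r.
Qed.

Lemma network_linear eps x : 0 < eps ->
  \sum_i relu (lin a b i x) <= eps ->
  network a b eps x = eps^-1 * \sum_i relu (lin a b i x).
Proof.
move=> eps0 le_eps; rewrite /network relu_id ?subKr //.
by rewrite subr_ge0 mulrC ler_pdivrMr // mul1r.
Qed.

Lemma sum_relu_ge1 i x : lin a b i x <= \sum_k relu (lin a b k x).
Proof.
rewrite (bigD1 i) //= (le_trans (le_relu _)) // lerDl.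
by apply: sumr_ge0 => k _; exact: relu_ge0.
Qed.

Lemma sum_relu_ge2 i j x : i != j ->
  lin a b i x + lin a b j x <= \sum_k relu (lin a b k x).
Proof.
move=> ij; rewrite (bigD1 i) //= (bigD1 j) //= 1?eq_sym // lerD ?le_relu //.
rewrite (le_trans (le_relu _)) // lerDl.
by apply: sumr_ge0 => k _; exact: relu_ge0.
Qed.

Lemma sum_relu1 i x : 0 <= lin a b i x ->
  (forall k, k != i -> lin a b k x <= 0) ->
  \sum_k relu (lin a b k x) = lin a b i x.
Proof.
move=> i0 ki; rewrite (bigD1 i) //= relu_id // big1 ?addr0 // => k /ki.
exact: relu_eq0.
Qed.

Lemma sum_relu2 i j x : i != j -> 0 <= lin a b i x -> 0 <= lin a b j x ->
  (forall k, k != i -> k != j -> lin a b k x <= 0) ->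
  \sum_k relu (lin a b k x) = lin a b i x + lin a b j x.
Proof.
move=> ij i0 j0 kij; rewrite (bigD1 i) //= (bigD1 j) //= 1?eq_sym //.
rewrite !relu_id // big1 ?addr0 // => k /andP[ki kj].
by apply: relu_eq0; exact: kij.
Qed.

Lemma linD i j x :
  dot (a i + a j) x - (b i + b j) = lin a b i x + lin a b j x.
Proof. by rewrite /lin !dotE !mxE; ring. Qed.

Lemma consecutive_neq i j : consecutive i j -> i != j.
Proof. by move=> /eqP ij; apply/eqP => e; move: ij; rewrite e => /n_Sn. Qed.

End Network.

(** * The error of the network on each region *)

Theorem lemma4p1 (R : realType) (n : nat) (eps : R)
    (Omega1 Omega2 : set 'rV[R]_2)
    (p : 'I_n.+1 -> 'rV[R]_2) (a : 'I_n -> 'rV[R]_2) (b : 'I_n -> R)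
    (chi : 'rV[R]_2 -> R)
    (n_ge2 : (2 <= n)%N) (eps_gt0 : 0 < eps)
    (partO : is_partition (@unit_square R) Omega1 Omega2)
    (convO1 : convex_set (Omega1 : set (convex_lmodType 'rV[R]_2)))
    (interO : polygonal_interface a b Omega1 Omega2 p)
    (eps_small : corners_separate a b Omega2 eps)
    (chi1 : forall x, Omega1 x -> chi x = 0)
    (chi2 : forall x, Omega2 x -> chi x = 1) :
  [/\ forall x, (@unit_square R `\` Upsilons a b Omega2 eps) x ->
        (Omega1 `|` Omega2) x -> ~ cuts a b Omega2 eps x ->
        chi x - network a b eps x = 0,
      forall (i : 'I_n) x, Upsilon1 a b Omega2 eps i x ->
        chi x - network a b eps x =
        chi x - eps^-1 * (dot (a i) x - b i) &
      forall (i j : 'I_n) x, consecutive i j ->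
        Upsilon2 a b Omega2 eps i j x ->
        chi x - network a b eps x =
        chi x - eps^-1 * (dot (a i + a j) x - (b i + b j))].
Proof.
(* A base point for the radial arguments; it exists because a vertex of the chain lies in the
   closure of [Omega1]. *)
have [y y1] : exists y, Omega1 y.
  have i0 : 'I_n by exact: Ordinal (ltnW n_ge2).
  have [clp _] := side_boundary partO interO (side_startP p i0).
  by have [y [y1 _]] := clp _ filterT; exists y.
have eps_neq0 : eps != 0 by rewrite gt_eqF.
have next := lin_gt0_next partO convO1 interO y1.
have prev := lin_gt0_prev partO convO1 interO y1.
split=> [x [Ox nU] x12 ncut|i x [[x2 xeps] /andP[i0 ieps] nb]|
         i j x cij [[x2 xeps] i0 j0 ijeps]].
- apply/eqP; rewrite subr_eq0; apply/eqP.
  case: x12 => [x1|x2].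
    rewrite (chi1 x x1) /network big1 ?mulr0 ?subr0 ?relu_id ?subrr ?ler01 //.
    by move=> i _; rewrite relu_eq0 // ltW // (lin_lt0 partO convO1 interO).
  rewrite (chi2 x x2); apply/esym/network_eq1 => //.
  (* A sum below [eps] would put [x] in a subregion: of the second type if two consecutive forms are
     positive, of the first type otherwise. *)
  rewrite leNgt; apply/negP => sum_lt.
  have sx : strip a b Omega2 eps x.
    by split => // i; apply: le_lt_trans sum_lt; exact: sum_relu_ge1.
  have lin_neq0 i : lin a b i x != 0.
    by apply: contra_notN ncut => /eqP ix; split => //; exists i.
  have [i ix] := lin_gt0_exists partO convO1 interO y1 x2.
  have pair j k : consecutive j k -> 0 < lin a b j x -> lin a b k x < 0.
    move=> jk jx; rewrite lt_neqAle lin_neq0 leNgt; apply/negP => kx.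
    apply: nU; right; exists (j, k) => //; split => //.
    rewrite linD; apply: le_lt_trans sum_lt; apply: sum_relu_ge2.
    exact: consecutive_neq.
  apply: nU; left; exists i => //; split=> [//||j /orP[|ji]].
  - by rewrite ix sx.2.
  - by move=> /pair; exact.
  - rewrite lt_neqAle lin_neq0 leNgt; apply/negP => jx.
    by have := pair _ _ ji jx; rewrite ltNge ltW.
- congr (_ - _).
  (* Another positive index would make a neighbour of [i] positive, against [nb]. *)
  have sumE : \sum_k relu (lin a b k x) = lin a b i x.
    apply: sum_relu1 => [|k ki]; first exact: ltW.
    rewrite leNgt; apply/negP => kx.
    move: ki; rewrite neq_ltn => /orP[ki|ik].
    + have [m mi mx] := prev _ _ _ x2 ki kx i0.
      by have := nb m; rewrite /neighbours mi orbT => /(_ isT); rewrite ltNge ltW.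
    + have [m im mx] := next _ _ _ x2 ik i0 kx.
      by have := nb m; rewrite /neighbours im => /(_ isT); rewrite ltNge ltW.
  by rewrite network_linear // sumE // ltW.
- congr (_ - _); rewrite linD in ijeps *.
  (* A third positive index would put [x] in the corner before or after that of [i] and [j], against
     [eps_small]. *)
  have sumE : \sum_k relu (lin a b k x) = lin a b i x + lin a b j x.
    apply: sum_relu2 => [|||k ki kj]; try exact: ltW.
      exact: consecutive_neq.
    rewrite leNgt; apply/negP => kx.
    have sx : strip a b Omega2 eps x by [].
    have [ki' kj'] : k <> i /\ k <> j by split; apply/eqP.
    move: ki; rewrite neq_ltn => /orP[ki|ik].
    + have [m mi mx] := prev _ _ _ x2 ki kx i0.
      have [] : (m, i) = (i, j).
        by apply: eps_small => //; exists x; split; split.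
      by move=> _ /eqP; rewrite (negbTE (consecutive_neq cij)).
    + have jk : (j < k)%N.
        by rewrite ltn_neqAle eq_sym kj (eqP cij).
      have [m jm mx] := next _ _ _ x2 jk j0 kx.
      have [] : (i, j) = (j, m).
        by apply: eps_small => //; exists x; split; split.
      by move=> /eqP; rewrite (negbTE (consecutive_neq cij)).
  by rewrite network_linear // sumE // ltW.
Qed.
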